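(* Let $\mathcal{A}$ be a complex unital $C^*$-algebra and let $a\in\mathcal{A}$ be a non-zero positive element. Let $\phi$ be an Orlicz function, let $n\ge1$ be an integer, let $x_i\in\mathcal{A}_a$ with $a$-adjoints $x_i^{\#_a}$ for $i=1,\dots,n$, and let $P=(p_1,\dots,p_n)$ be a probability distribution, i.e. $p_i\ge0$ for all $i$ and $\sum_{i=1}^n p_i=1$. Then $$\phi\left(v_a^2\Big(\sum_{i=1}^{n}p_ix_i\Big)\right)\le \frac12\phi\left(v_a\Big(\sum_{i=1}^{n}p_ix_i^2\Big)\right)+\frac12\phi\left(\Big\|\sum_{i=1}^{n}p_ix_i^{\#_a}x_i\Big\|_a^{\frac12}\Big\|\sum_{i=1}^{n}p_ix_ix_i^{\#_a}\Big\|_a^{\frac12}\right).$$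
   Context: A functional $f\in\mathcal{A}^*$ is positive ($f\ge 0$) if $f(x^*x)\ge 0$ for all $x\in\mathcal{A}$. $\mathcal{S}_a(\mathcal{A})=\{f\in\mathcal{A}^*: f\ge0,\ f(a)=1\}$; the $a$-numerical radius is $v_a(x)=\sup\{|f(ax)|: f\in\mathcal{S}_a(\mathcal{A})\}$; and $\|x\|_a=\sup\{\sqrt{f(x^*ax)}: f\in\mathcal{S}_a(\mathcal{A})\}$ (possibly $+\infty$ in general, but finite on $\mathcal{A}_a$). An $a$-adjoint of $x\in\mathcal{A}$ is an element $x^{\#_a}\in\mathcal{A}$ with $ax^{\#_a}=x^*a$ (it need not exist or be unique); $\mathcal{A}_a$ is the set of all elements of $\mathcal{A}$ that have an $a$-adjoint. The notation $v_a^2(x)$ means $(v_a(x))^2$. An Orlicz function is a map $\phi:[0,\infty)\to[0,\infty)$ that is continuous, convex, non-decreasing, with $\phi(0)=0$ and $\phi(u)\to\infty$ as $u\to\infty$; it is always assumed non-degenerate, i.e. $\phi(u)>0$ for $u>0$. *)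

(* Defs.v *)
From HB Require Import structures.
From mathcomp Require Import all_boot all_order all_algebra.
From mathcomp Require Import all_classical all_reals all_analysis.
From mathcomp Require Import complex.

Set Implicit Arguments.
Unset Strict Implicit.
Unset Printing Implicit Defensive.

Import Order.TTheory GRing.Theory Num.Theory numFieldNormedType.Exports.

Local Open Scope classical_set_scope.
Local Open Scope ring_scope.
Local Open Scope complex_scope.

(* Modulus of a complex number, as an element of R (`|z| lives in R[i]). *)
Definition cmod (R : realType) (z : R[i]) : R := complex.Re `|z|.

(* Unital complex C*-algebras. The norm is a field of the mixin because
   Hierarchy Builder admits no join of ring structures with the normed
   modules of MathComp-Analysis (that join would have to be declared below
   numDomainType). It is real-valued. algType includes 1 != 0, so
   the zero algebra (which has no non-zero element) is excluded. *)
HB.mixin Record isCStarAlgebra (R : realType) (A : Type)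
    of GRing.Algebra R[i] A := {
  cnorm : A -> R ;
  star : A -> A ;
  cnorm_eq0 : forall x : A, cnorm x = 0 -> x = 0 ;
  cnormD : forall x y : A, cnorm (x + y) <= cnorm x + cnorm y ;
  cnormZ : forall (c : R[i]) (x : A), cnorm (c *: x) = cmod c * cnorm x ;
  cnormM : forall x y : A, cnorm (x * y) <= cnorm x * cnorm y ;
  cnorm_complete : forall u : nat -> A,
    (forall e : R, 0 < e -> exists N : nat, forall m n : nat,
      (N <= m)%N -> (N <= n)%N -> cnorm (u m - u n) < e) ->
    exists l : A, forall e : R, 0 < e -> exists N : nat, forall n : nat,
      (N <= n)%N -> cnorm (u n - l) < e ;
  starK : forall x : A, star (star x) = x ;
  starD : forall x y : A, star (x + y) = star x + star y ;
  starZ : forall (c : R[i]) (x : A), star (c *: x) = (c^*)%C *: star x ;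
  starM : forall x y : A, star (x * y) = star y * star x ;
  cnorm_star : forall x : A, cnorm (star x * x) = cnorm x ^+ 2
}.

#[short(type="cstarAlgType")]
HB.structure Definition CStarAlgebra (R : realType) :=
  {A of isCStarAlgebra R A & GRing.Algebra R[i] A}.

Section CStar.
Context {R : realType} {A : cstarAlgType R}.
Implicit Types (a x y : A) (f : {scalar A}).

Definition spectrum x : set R[i] :=
  [set l | ~ exists y, (x - l *: 1) * y = 1 /\ y * (x - l *: 1) = 1].

(* In the order of R[i], 0 <= l says that l is real and nonnegative. *)
Definition positive_elt x : Prop :=
  star x = x /\ forall l, spectrum x l -> 0 <= l.

(* The dual space: linear functionals that are bounded for cnorm. *)
Definition dual : set {scalar A} :=
  [set f | exists M : R, forall x, cmod (f x) <= M * cnorm x].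

Definition positive_functional f : Prop := forall x, 0 <= f (star x * x).

Definition a_states a : set {scalar A} :=
  [set f | [/\ dual f, positive_functional f & f a = 1]].

Local Open Scope ereal_scope.

Definition a_numerical_radius a x : \bar R :=
  ereal_sup [set (cmod (f (a * x)%R))%:E | f in a_states a].

(* For a positive the values f (star x * a * x) are real and nonnegative. *)
Definition a_norm a x : \bar R :=
  ereal_sup
    [set (Num.sqrt (complex.Re (f (star x * a * x)%R)))%:E | f in a_states a].

Definition is_a_adjoint a x y : Prop := (a * y = star x * a)%R.

(* The set A_a of the elements that have an a-adjoint. *)
Definition a_adjointable a : set A := [set x | exists y, is_a_adjoint a x y].

End CStar.

(* Orlicz functions are maps on [0, +oo[; only these values of phi matter. *)
Record orlicz_function (R : realType) (phi : R -> R) : Prop := {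
  orlicz_ge0 : forall u, 0 <= u -> 0 <= phi u ;
  orlicz_continuous : {within `[0, +oo[, continuous phi} ;
  orlicz_convex : convex_function (E := R^o) `[0, +oo[ phi ;
  orlicz_homo : {in `[0, +oo[ &, {homo phi : u v / u <= v}} ;
  orlicz0 : phi 0 = 0 ;
  orlicz_cvgy : phi u @[u --> +oo] --> +oo ;
  orlicz_gt0 : forall u, 0 < u -> 0 < phi u
}.

(* Main.v *)
(* Each state f with f(a) = 1 carries the semi-inner product
   <u, v> = f(v^* a u), in which 1 is a unit vector and an a-adjoint of x acts
   as an adjoint of x.  On A^n with the weights p_i, Buzano's inequality
     2 |<u, e> <e, v>| <= |<u, v>| + |u| |v|
   for u = (x_i), v = (x_i^#) and the unit vector e = (1, ..., 1) reads
     2 |f(a sum p_i x_i)|^2 <= |f(a sum p_i x_i^2)|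
       + f(a sum p_i x_i^# x_i)^(1/2) f(a sum p_i x_i x_i^#)^(1/2);
   the supremum over f, monotonicity and midpoint convexity of phi conclude.

   Two points need work.  Positivity of <u, u> from the spectral definition of
   a >= 0: for t > 0 the element a + t is d^* d with d invertible, which is
   clear for large t and propagates down to 0, the length of the steps being
   controlled by the resolvent.  Finiteness of the suprema: for a S = S^* a,
   iterated Cauchy-Schwarz bounds |f(a S)| by the norm of S. *)

Require Import Defs.
From HB Require Import structures.
From mathcomp Require Import all_boot all_order all_algebra.
From mathcomp Require Import all_classical all_reals all_analysis.
From mathcomp Require Import complex.
From mathcomp Require Import ring lra.

Set Implicit Arguments.
Unset Strict Implicit.
Unset Printing Implicit Defensive.

Import Order.TTheory GRing.Theory Num.Theory numFieldNormedType.Exports.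

Local Open Scope ring_scope.
Local Open Scope complex_scope.

(** * The real-valued modulus on [R[i]] *)

Section ComplexModulus.
Context {R : realType}.
Implicit Types (r : R) (z w : R[i]).

Lemma conjcN z : ((- z)^*)%C = - (z^*)%C.
Proof. exact: rmorphN. Qed.

Lemma conjcM z w : ((z * w)^*)%C = (z^*)%C * (w^*)%C.
Proof. exact: rmorphM. Qed.

Lemma conjc_sum (I : Type) (s : seq I) (F : I -> R[i]) :
  ((\sum_(i <- s) F i)^*)%C = \sum_(i <- s) ((F i)^*)%C.
Proof. exact: (rmorph_sum (@conjc R)). Qed.

Lemma normcE_cmod z : `|z| = (cmod z)%:C :> R[i].
Proof. by rewrite /cmod normc_def. Qed.

Lemma cmodr r : cmod r%:C = `|r|.
Proof. by rewrite /cmod normc_def /= expr0n addr0 sqrtr_sqr. Qed.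

Lemma Im_realM r z : complex.Im (r%:C * z) = r * complex.Im z.
Proof. by case: z => u v /=; rewrite mul0r addr0. Qed.

Lemma cmodM z w : cmod (z * w) = cmod z * cmod w.
Proof. by apply: complexI; rewrite rmorphM -!normcE_cmod normrM. Qed.

Lemma cmodD_le z w : cmod (z + w) <= cmod z + cmod w.
Proof. by rewrite -lecR rmorphD -!normcE_cmod ler_normD. Qed.

Lemma cmod_ge0 z : 0 <= cmod z.
Proof. by rewrite -ler0c -normcE_cmod. Qed.

Lemma Re_le_cmod z : complex.Re z <= cmod z.
Proof.
rewrite -lecR -normcE_cmod; apply: le_trans (normc_ge_Re z).
by rewrite lecR ler_norm.
Qed.

End ComplexModulus.

(** * Norm and involution; square roots near the unit *)

Section CStarNorm.
Context {R : realType} {A : cstarAlgType R}.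
Implicit Types (x y h : A) (r : R).

Lemma cnorm0 : cnorm (0 : A) = 0.
Proof. by rewrite -(scale0r (0 : A)) cnormZ (cmodr 0) normr0 mul0r. Qed.

Lemma cnormN x : cnorm (- x) = cnorm x.
Proof. by rewrite -scaleN1r cnormZ /cmod normrN1 mul1r. Qed.

Lemma cnorm_ge0 x : 0 <= cnorm x.
Proof.
have := cnormD x (- x); rewrite subrr cnorm0 cnormN => h.
by lra.
Qed.

Lemma cnorm_distC x y : cnorm (x - y) = cnorm (y - x).
Proof. by rewrite -cnormN opprB. Qed.

Lemma cnorm_dist_triangle y x z : cnorm (x - z) <= cnorm (x - y) + cnorm (y - z).
Proof. by apply: le_trans (cnormD _ _); rewrite subrKA. Qed.

(** The C*-identity gives [cnorm z ^+ 2 <= cnorm (star z) * cnorm z]; divide by [cnorm z], then use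
    that [star] is involutive. *)
Lemma cnorm_starE x : cnorm (star x) = cnorm x.
Proof.
suff le (z : A) : cnorm z <= cnorm (star z).
  by apply/eqP; rewrite eq_le le andbT; have := le (star x); rewrite starK.
have [->|z0] := eqVneq (cnorm z) 0; first exact: cnorm_ge0.
have zp : 0 < cnorm z by rewrite lt_neqAle eq_sym z0 cnorm_ge0.
by rewrite -(ler_pM2r zp) -expr2 -cnorm_star cnormM.
Qed.

Lemma star0 : star (0 : A) = 0.
Proof. by rewrite -[in LHS](scale0r (0 : A)) starZ conjc0 scale0r. Qed.

Lemma star1 : star (1 : A) = 1.
Proof. by rewrite -[LHS]mulr1 -{2}(starK 1) -starM mulr1 starK. Qed.

Lemma starZr r x : star (r%:C *: x) = r%:C *: star x.
Proof. by rewrite starZ conjc_real. Qed.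

Lemma starN x : star (- x) = - star x.
Proof. by apply/eqP; rewrite -addr_eq0 -starD addNr star0. Qed.

Lemma starB x y : star (x - y) = star x - star y.
Proof. by rewrite starD starN. Qed.

Lemma star_sum (I : Type) (s : seq I) (F : I -> A) :
  star (\sum_(i <- s) F i) = \sum_(i <- s) star (F i).
Proof. exact: (big_morph star starD star0). Qed.

Lemma cnormX x k : cnorm (x ^+ k.+1) <= cnorm x ^+ k.+1.
Proof.
elim: k => [|k IH]; first by rewrite !expr1.
rewrite exprS [leRHS]exprS; apply: le_trans (cnormM _ _) _.
by rewrite ler_wpM2l ?cnorm_ge0.
Qed.

Lemma cnorm_small_eq0 x :
  (forall e : R, 0 < e -> cnorm x <= e) -> x = 0.
Proof.
move=> small; apply: cnorm_eq0; apply/eqP.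
rewrite eq_le cnorm_ge0 andbT; apply/ler_addgt0Pr => e e0.
by rewrite add0r small.
Qed.

(* The self-adjoint root is [1 - y], where [y] is the fixed point of the
   contraction [y |-> (h + y ^+ 2) / 2] of the ball of radius 1/2. *)
Lemma selfadjoint_sqrt_near1 h : star h = h -> cnorm h <= 4^-1 ->
  exists c, star c = c /\ c * c = 1 - h.
Proof.
move=> hh h4.
pose T y : A := 2^-1%:C *: (h + y * y).
have cT y z : cnorm y <= 2^-1 -> cnorm z <= 2^-1 ->
    cnorm (T y - T z) <= 2^-1 * cnorm (y - z).
  move=> y2 z2; rewrite /T -scalerBr cnormZ cmodr gtr0_norm ?invr_gt0//.
  rewrite ler_wpM2l ?invr_ge0// opprD addrACA subrr add0r.
  have -> : y * y - z * z = y * (y - z) + (y - z) * z.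
    by rewrite mulrBr mulrBl subrKA.
  apply: le_trans (cnormD _ _) _.
  have := cnormM y (y - z); have := cnormM (y - z) z.
  have := cnorm_ge0 (y - z); nra.
have bT y : cnorm y <= 2^-1 -> cnorm (T y) <= 2^-1.
  move=> y2; rewrite /T cnormZ cmodr gtr0_norm ?invr_gt0//.
  have := cnormD h (y * y); have := cnormM y y; have := cnorm_ge0 y; nra.
pose u k := iter k T 0.
have bu k : cnorm (u k) <= 2^-1.
  by elim: k => [|k IH]; rewrite /= ?cnorm0 ?invr_ge0//; exact: bT.
have su k : star (u k) = u k.
  by elim: k => [|k IH]; rewrite /= ?star0// /T starZr starD starM hh IH.
(* The two terms are the images of [u m] and [0] under [k] steps of the contraction. *)
have du m k : cnorm (u (m + k)%N - u k) <= 2^-1 ^+ k.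
  elim: k => [|k IH].
    rewrite addn0 subr0 expr0; apply: le_trans (bu m) _.
    by rewrite invf_le1 ?ler1n.
  rewrite addnS; apply: le_trans (cT _ _ (bu _) (bu _)) _.
  by rewrite exprS ler_wpM2l ?invr_ge0.
have geo (e : R) : 0 < e -> exists N, 2^-1 ^+ N < e :> R.
  move=> e0; have h1 : `|2^-1 : R| < 1.
    by rewrite ger0_norm ?invr_ge0// invf_lt1 ?ltr1n.
  have /cvgrPdist_lt/(_ _ e0)[N _ /(_ N (leqnn N))] := cvg_expr h1.
  by rewrite sub0r normrN ger0_norm ?exprn_ge0 ?invr_ge0// => ?; exists N.
have [] := @cnorm_complete _ A u.
  move=> e e0; have [N Ne] := geo _ e0; exists N => m n.
  wlog nm : m n / (n <= m)%N => [W Nm Nn|Nm Nn].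
    by have [/W|/ltnW/W] := leqP n m; [|rewrite cnorm_distC]; apply.
  rewrite -(subnK nm); apply: le_lt_trans (du _ _) _.
  apply: le_lt_trans Ne; apply: ler_wiXn2l => //.
  by rewrite invf_le1 ?ler1n.
move=> l cl.
have bl : cnorm l <= 2^-1.
  apply/ler_addgt0Pr => e /cl[N /(_ N (leqnn N))].
  have := cnorm_dist_triangle (u N) l 0; rewrite !subr0 cnorm_distC => *.
  have := bu N; lra.
have sl : star l = l.
  apply/eqP; rewrite -subr_eq0; apply/eqP/cnorm_small_eq0 => e e0.
  have [|N /(_ N (leqnn N))] := cl (e / 2); first by rewrite divr_gt0.
  have := cnorm_dist_triangle (u N) (star l) l.
  by rewrite -{1}(su N) -starB cnorm_starE [cnorm (l - u N)]cnorm_distC => *; lra.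
have Tl : l = T l.
  apply/eqP; rewrite -subr_eq0; apply/eqP/cnorm_small_eq0 => e e0.
  have [|N cN] := cl (e / 2); first by rewrite divr_gt0.
  have := cnorm_dist_triangle (u N.+1) l (T l).
  have := cT _ _ (bu N) bl; have := cN _ (leqnn N); have := cN _ (leqnSn N).
  rewrite -[T (u N)]/(u N.+1) [cnorm (l - u N.+1)]cnorm_distC => *.
  lra.
exists (1 - l); split; first by rewrite starB star1 sl.
have /(congr1 (fun x => 2%:C *: x)) := Tl.
rewrite /T scalerA -rmorphM mulfV// scale1r rmorphD scalerDl scale1r => E.
by rewrite mulrBr mulr1 mulrBl mul1r -addrA -opprD addrA E addrK.
Qed.

End CStarNorm.

(** * Spectrally positive elements as limits of [star d * d] *)

Section PositiveElements.
Context {R : realType} {A : cstarAlgType R}.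
Implicit Types (x y h d k : A) (r s t : R).

Definition is_inverse x y : Prop := x * y = 1 /\ y * x = 1.

(** An algebraic form of strict positivity. The inverse of [d] lets a small perturbation be moved
    between [star d] and [d]. *)
Definition gram_unit x : Prop := exists d di, is_inverse d di /\ x = star d * d.

Lemma is_inverse_star x y : is_inverse x y -> is_inverse (star x) (star y).
Proof. by case=> xy yx; split; rewrite -starM ?yx ?xy star1. Qed.

Lemma is_inverse_gram d di :
  is_inverse d di -> is_inverse (star d * d) (di * star di).
Proof.
move=> ddi; have [sdi dis] := is_inverse_star ddi; case: ddi => ddi did.
split; first by rewrite mulrA -[star d * d * di]mulrA ddi mulr1.
by rewrite mulrA -[di * star di * star d]mulrA dis mulr1.
Qed.

Lemma is_inverse_root x y : is_inverse (x * x) y -> exists z, is_inverse x z.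
Proof.
case=> xxy yxx; have yx : y * x = x * y.
  by rewrite -[LHS]mulr1 -xxy !mulrA -(mulrA y) yxx mul1r.
by exists (x * y); split; [rewrite mulrA|rewrite -yx -mulrA].
Qed.

(* [star d * d + k = star d * (1 + star di * k * di) * d] and the middle factor
   is the square of a self-adjoint element. *)
Lemma gram_unit_perturb d di k : is_inverse d di -> star k = k ->
  cnorm (star di * k * di) <= 4^-1 ->
  (exists y, is_inverse (star d * d + k) y) -> gram_unit (star d * d + k).
Proof.
move=> ddi kk small [y [dky kdy]].
have [sdi dis] := is_inverse_star ddi; case: (ddi) => ddi1 did.
have [||c [sc cc]] := @selfadjoint_sqrt_near1 _ _ (- (star di * k * di)).
- by rewrite starN !starM kk starK mulrA.
- by rewrite cnormN.
rewrite opprK in cc.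
have dccd : star d * (c * c) * d = star d * d + k.
  rewrite cc mulrDr mulr1 mulrDl !mulrA sdi mul1r.
  by rewrite -(mulrA k) did mulr1.
(* [c * c] is a product of three invertible elements, hence [c] is invertible. *)
have [c' [cc' c'c]] : exists z, is_inverse c z.
  have ccE : c * c = star di * (star d * d + k) * di.
    rewrite -dccd !mulrA dis mul1r -!mulrA ddi1 !mulr1 //.
  apply: (@is_inverse_root _ (d * y * star d)); rewrite ccE; split.
    rewrite !mulrA -(mulrA _ di d) did mulr1.
    by rewrite -(mulrA (star di)) dky mulr1 dis.
  rewrite !mulrA -(mulrA _ (star d) (star di)) sdi mulr1.
  by rewrite -(mulrA d) kdy mulr1 ddi1.
exists (c * d), (di * c'); split; last by rewrite -dccd starM sc !mulrA.
split; first by rewrite mulrA -(mulrA c) ddi1 mulr1.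
by rewrite mulrA -(mulrA di) c'c mulr1.
Qed.

(** By the C*-identity [star di * di] has the norm of [di * star di], the inverse of [star d * d];
    the admissible shift is thus governed by the resolvent. *)
Lemma gram_unit_shift d di r : is_inverse d di ->
  `|r| * cnorm (di * star di) <= 4^-1 ->
  (exists y, is_inverse (star d * d + r%:C *: 1) y) ->
  gram_unit (star d * d + r%:C *: 1).
Proof.
move=> ddi small; apply: gram_unit_perturb ddi _ _; first by rewrite starZr star1.
rewrite -scalerAr mulr1 -scalerAl cnormZ cmodr cnorm_star.
by rewrite -cnorm_starE -cnorm_star starK.
Qed.

Lemma positive_shift_unit h t : positive_elt h -> 0 < t ->
  exists y, is_inverse (h + t%:C *: 1) y.
Proof.
case=> _ ph t0; apply: contrapT => nh.
have /ph : spectrum h (- t%:C).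
  move=> [y]; rewrite scaleNr opprK => hy; apply: nh; exists y; exact: hy.
by rewrite oppr_ge0 lecR leNgt t0.
Qed.

(** Here [h] is the perturbation, and [t] is the square of [d = sqrt t]; the factor 4 comes from the
    radius [4^-1] for square roots. *)
Lemma gram_unit_large h t : positive_elt h -> 0 < t -> 4 * cnorm h <= t ->
  gram_unit (h + t%:C *: 1).
Proof.
move=> ph t0 ht; pose q := Num.sqrt t.
have q0 : 0 < q by rewrite sqrtr_gt0.
have q0' : q != 0 by rewrite gt_eqF.
have qq : q * q = t by rewrite -expr2 sqr_sqrtr// ltW.
have tE : t%:C *: 1 = star (q%:C *: 1) * (q%:C *: 1) :> A.
  by rewrite starZr star1 -scalerAl mul1r scalerA -rmorphM qq.
rewrite addrC tE; apply: (@gram_unit_perturb _ (q^-1%:C *: 1)).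
- by split; rewrite -scalerAl mul1r scalerA -rmorphM ?mulfV// ?mulVf// scale1r.
- by case: ph.
- rewrite starZr star1 -scalerAl mul1r -scalerAr mulr1 scalerA -rmorphM.
  rewrite -invfM qq cnormZ cmodr gtr0_norm ?invr_gt0//.
  by rewrite mulrC ler_pdivrMr// -(ler_pM2l (ltr0n R 4)) mulrA mulfV// mul1r.
- by rewrite -tE addrC; exact: positive_shift_unit.
Qed.

(* Descent on [t]: a step of length [1 / (4 * |(h + t)^-1|)] is always
   possible, and this length is bounded below near every [t0 > 0]. *)
Lemma positive_shift_gram h t : positive_elt h -> 0 < t ->
  gram_unit (h + t%:C *: 1).
Proof.
move=> ph t_gt0.
(* Quantifying over all [s >= t] makes everything above [inf S] good, so it suffices that
   [inf S <= 0]. *)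
pose S := [set t | 0 < t /\ forall s, t <= s -> gram_unit (h + s%:C *: 1)]%classic.
have lbS : lbound S 0 by move=> s [/ltW].
have hS : has_inf S.
  split; last by exists 0.
  pose b := 4 * cnorm h + 1.
  have b0 : 0 < b by rewrite ltr_wpDl ?ltr01// mulr_ge0 ?cnorm_ge0.
  exists b; split=> // s bs; apply: gram_unit_large => //.
    exact: lt_le_trans bs.
  by apply: le_trans bs; rewrite lerDl.
have infS s : inf S < s -> gram_unit (h + s%:C *: 1).
  rewrite -subr_gt0 => /(inf_adherent)/(_ hS)[u [_ uS]].
  by rewrite subrKC => /ltW; exact: uS.
apply: (infS); apply: le_lt_trans t_gt0; rewrite leNgt; apply/negP => i0.
set i := inf S in infS i0.
have [r0 [ir r0i]] := positive_shift_unit ph i0.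
pose N := cnorm r0 + 1.
have N0 : 0 < N by rewrite ltr_wpDl ?cnorm_ge0.
(* The bound [i / 2] keeps [i - e] positive. The other one gives [cnorm re <= 2 * N] below, so that
   shifts from [i + e] of length up to [2 * e] are admissible: [2 * e * (2 * N) <= 4^-1]. *)
pose e := Num.min (i / 2) (16 * N)^-1.
have e0 : 0 < e by rewrite lt_min divr_gt0//= invr_gt0 mulr_gt0.
have eN : e * N <= 16^-1.
  have : e <= (16 * N)^-1 by rewrite ge_min lexx orbT.
  by rewrite invfM -ler_pdivlMr// invrK.
have ei : e <= i / 2 by rewrite ge_min lexx.
have [d [di [ddi hd]]] : gram_unit (h + (i + e)%:C *: 1).
  by apply: infS; rewrite ltrDl.
have [hre reh] := is_inverse_gram ddi; rewrite -hd in hre reh.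
set re := di * star di in hre reh.
have bre : cnorm re <= 2 * N.
  (* The resolvent identity between [i] and [i + e]. *)
  have E : re = r0 - e%:C *: (re * r0).
    apply/eqP; rewrite eq_sym subr_eq; apply/eqP.
    rewrite -[LHS]mul1r -[1 in LHS]reh rmorphD scalerDl addrA.
    rewrite mulrDr mulrDl -[re * _ * r0]mulrA ir mulr1.
    by rewrite -scalerAr mulr1 -scalerAl.
  have := cnormD r0 (- (e%:C *: (re * r0))); rewrite -E cnormN cnormZ cmodr.
  rewrite gtr0_norm// => b1.
  have b2 : e * cnorm (re * r0) <= e * (cnorm re * cnorm r0).
    by rewrite ler_pM2l ?cnormM.
  have r0N : cnorm r0 <= N by rewrite lerDl.
  have b3 : (e * cnorm r0) * cnorm re <= 16^-1 * cnorm re.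
    rewrite ler_wpM2r ?cnorm_ge0//; apply: le_trans eN.
    by rewrite ler_pM2l.
  have := cnorm_ge0 re; lra.
(* A single shift from [i + e] covers all of [[i - e, i]], contradicting the choice of [i]. *)
have : S (i - e).
  split; first lra.
  move=> s ies; have [ise|] := ltP i s; first exact: infS.
  move=> si; have -> : h + s%:C *: 1 = star d * d + (s - (i + e))%:C *: 1.
    by rewrite -hd -addrA -scalerDl -rmorphD subrKC.
  apply: (gram_unit_shift ddi).
    rewrite -/re; apply: (@le_trans _ _ ((2 * e) * (2 * N))); last lra.
    apply: ler_pM => //; first exact: cnorm_ge0.
    by rewrite ler_norml; apply/andP; split; lra.
  rewrite -hd -addrA -scalerDl -rmorphD subrKC.
  apply: positive_shift_unit => //; lra.
move/(ge_inf hS.2); rewrite -/i; lra.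
Qed.

End PositiveElements.

(** * Cauchy-Schwarz and Buzano for possibly degenerate forms *)

Section SemiInnerProduct.
Context {R : realType} {V : lmodType R[i]}.
Implicit Types (B : V -> V -> R[i]) (u v w e : V).

Record semi_inner B : Prop := {
  semi_innerDl : forall u v w, B (u + v) w = B u w + B v w ;
  semi_innerZl : forall c u w, B (c *: u) w = c * B u w ;
  semi_innerC : forall u v, B v u = ((B u v)^*)%C ;
  semi_inner_ge0 : forall u, 0 <= B u u
}.

Variable B : V -> V -> R[i].
Hypothesis hB : semi_inner B.

Lemma semi_innerDr u v w : B w (u + v) = B w u + B w v.
Proof. by rewrite !(semi_innerC hB _ w) (semi_innerDl hB) rmorphD. Qed.

Lemma semi_innerZr c u w : B w (c *: u) = (c^*)%C * B w u.
Proof. by rewrite !(semi_innerC hB _ w) (semi_innerZl hB) rmorphM. Qed.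

Lemma semi_inner_diagE u : B u u = (complex.Re (B u u))%:C.
Proof. by rewrite RRe_real// ger0_real// (semi_inner_ge0 hB). Qed.

Lemma semi_inner_diag_ge0 u : 0 <= complex.Re (B u u).
Proof. by rewrite -ler0c -semi_inner_diagE (semi_inner_ge0 hB). Qed.

Lemma mulC_cmod (z : R[i]) : z * (z^*)%C = (cmod z ^+ 2)%:C.
Proof. by rewrite -sqr_normc normcE_cmod rmorphXn. Qed.

Lemma semi_inner_CauchySchwarz u v :
  cmod (B u v) ^+ 2 <= complex.Re (B u u) * complex.Re (B v v).
Proof.
set z := B u v; set m := cmod z ^+ 2.
have m0 : 0 <= m by rewrite sqr_ge0.
have mE : m%:C = z * (z^*)%C by rewrite mulC_cmod.
(* This quadratic in [s] is [B w w] for [w = u - (s * B u v) *: v]. *)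
clearbody m; have P (s : R) :
    0 <= complex.Re (B u u) - 2 * s * m + s ^+ 2 * m * complex.Re (B v v).
  rewrite -ler0c; pose c := - (s%:C * z).
  suff <- : B (u + c *: v) (u + c *: v) =
     (complex.Re (B u u) - 2 * s * m + s ^+ 2 * m * complex.Re (B v v))%:C.
    exact: semi_inner_ge0.
  rewrite (semi_innerDl hB) !semi_innerDr !(semi_innerZl hB) !semi_innerZr.
  rewrite (semi_innerC hB u v) -/z /c conjcN conjcM conjc_real.
  rewrite !(rmorphD, rmorphN, rmorphB, rmorphM, rmorphXn) /=.
  rewrite -!semi_inner_diagE mE rmorph1; set zz := (z^*)%C; ring.
have d0 := semi_inner_diag_ge0 v.
(* If [B v v = 0], the expression is affine in [s] and a large [s] makes it negative unless [m = 0];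
   otherwise its minimum is at [s = (B v v)^-1]. *)
have [v0|v0] := eqVneq (complex.Re (B v v)) 0.
  rewrite v0 mulr0 leNgt; apply/negP => mp.
  have := P ((complex.Re (B u u) + 1) / m).
  rewrite v0 mulr0 addr0 -mulrA divfK ?gt_eqF//.
  have := semi_inner_diag_ge0 u; lra.
have dp : 0 < complex.Re (B v v) by rewrite lt_neqAle eq_sym v0.
have := P (complex.Re (B v v))^-1.
have -> : (complex.Re (B v v))^-1 ^+ 2 * m * complex.Re (B v v) =
          (complex.Re (B v v))^-1 * m by field.
move=> h; rewrite -ler_pdivrMr// mulrC; lra.
Qed.

Lemma semi_inner_CauchySchwarz_sqrt u v : cmod (B u v) <=
  Num.sqrt (complex.Re (B u u)) * Num.sqrt (complex.Re (B v v)).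
Proof.
rewrite -sqrtrM ?semi_inner_diag_ge0//.
rewrite -[leLHS]ger0_norm ?cmod_ge0// -sqrtr_sqr ler_wsqrtr//.
exact: semi_inner_CauchySchwarz.
Qed.

(* Cauchy-Schwarz for [v] and the reflection of [u] in the line of [e]. *)
Lemma semi_inner_Buzano u v e : B e e = 1 ->
  2 * cmod (B u e * B e v) <= cmod (B u v) +
    Num.sqrt (complex.Re (B u u)) * Num.sqrt (complex.Re (B v v)).
Proof.
move=> e1; pose z := (2 * B u e) *: e + (- 1) *: u.
have zz : B z z = B u u.
  rewrite /z (semi_innerDl hB) !semi_innerDr !(semi_innerZl hB) !semi_innerZr.
  rewrite e1 (semi_innerC hB u e) conjcM conjcN conjc_nat conjc1.
  set b := B u e; set b' := (b^*)%C; ring.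
have zv : 2 * (B u e * B e v) = B z v + B u v.
  by rewrite /z (semi_innerDl hB) !(semi_innerZl hB); ring.
have -> : 2 * cmod (B u e * B e v) = cmod (2 * (B u e * B e v)).
  by rewrite [RHS]cmodM; congr (_ * _); rewrite /cmod ger0_norm ?ler0n.
rewrite zv -zz [leRHS]addrC; apply: (@le_trans _ _ (cmod (B z v) + cmod (B u v))).
  exact: cmodD_le.
by rewrite lerD2r semi_inner_CauchySchwarz_sqrt.
Qed.

End SemiInnerProduct.

(** * Positive functionals: hermitian symmetry and positivity on [star x * h * x] *)

Section PositiveFunctionals.
Context {R : realType} {A : cstarAlgType R}.
Variable f : {scalar A}.
Hypothesis pf : positive_functional f.
Implicit Types (x y h : A).

(** Polarization: [f] is real at [star (x + c) * (x + c)]; the cross terms for [c = 1] and [c = 'i]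
    compare the imaginary and the real parts. *)
Lemma positive_functional_star x : f (star x) = ((f x)^*)%C.
Proof.
have real (c : R[i]) : complex.Im (c * f (star x) + (c^*)%C * f x) = 0.
  have := ger0_Im (pf (x + c *: 1)).
  rewrite starD starZ star1 mulrDl !mulrDr -!scalerAr -!scalerAl mulr1 mul1r.
  rewrite !linearD /= !linearZ_LR /=.
  have /ger0_Im h1 := pf x; have := ger0_Im (pf 1); rewrite star1 mulr1 => h2.
  have h3 : complex.Im (c * ((c^*)%C * f 1)) = 0.
    by rewrite mulrA mulC_cmod Im_realM h2 mulr0.
  rewrite h1 h3; lra.
have := real 1; have := real 'i%C; move: (f (star x)) (f x) => [u v] [u' v'] /=.
rewrite !(mul0r, mul1r, mulr0, oppr0, addr0, add0r, subr0) => h1 h2.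
by congr Complex; lra.
Qed.

(** Writing [h + t = star d * d] turns the sandwich into [star (d * x) * (d * x)]; then [t] tends to
    0. *)
Lemma positive_functional_sandwich_ge0 h x :
  positive_elt h -> 0 <= f (star x * h * x).
Proof.
move=> ph.
have P (t : R) : 0 < t -> 0 <= f (star x * h * x) + t%:C * f (star x * x).
  move=> t0; have [d [_ [_ hd]]] := positive_shift_gram ph t0.
  have -> : f (star x * h * x) + t%:C * f (star x * x) = f (star (d * x) * (d * x)).
    rewrite starM mulrA -[star x * _ * d]mulrA -hd mulrDr mulrDl linearD /=.
    by rewrite -scalerAr mulr1 -scalerAl linearZ_LR.
  exact: pf.
have := pf x; move: (f (star x * x)) P => [w w'] P; move: (f _) P => [z z'] P.
rewrite !lecE /= => /andP[/eqP w'0 w0].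
have P' (t : R) : 0 < t -> (z' == 0) && (0 <= z + t * w).
  by move=> /P; rewrite lecE /= w'0 !(mulr0, mul0r, subr0, addr0, eqxx).
have /andP[-> _] := P' 1 ltr01.
(* [t = e / (w + 1)] gives [t * w <= e], also for [w = 0]. *)
apply/ler_addgt0Pr => e e0; have w1 : 0 < w + 1 by rewrite ltr_wpDl.
have /andP[_ /le_trans] := P' (e / (w + 1)) (divr_gt0 e0 w1); apply.
rewrite lerD2l mulrAC ler_pdivrMr// ler_pM2l//; lra.
Qed.

End PositiveFunctionals.

Lemma semi_inner_weighted_sum (R : realType) (V : lmodType R[i]) (I : finType)
    (p : I -> R) (B : V -> V -> R[i]) : (forall i, 0 <= p i) -> semi_inner B ->
  semi_inner (fun u v : {ffun I -> V} => \sum_i (p i)%:C * B (u i) (v i)).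
Proof.
move=> p0 hB; split=> [u v w|c u w|u v|u].
- rewrite -big_split; apply: eq_bigr => i _.
  by rewrite ffunE (semi_innerDl hB) mulrDr.
- rewrite mulr_sumr; apply: eq_bigr => i _.
  by rewrite ffunE (semi_innerZl hB) mulrCA.
- rewrite conjc_sum; apply: eq_bigr => i _.
  by rewrite conjcM conjc_real (semi_innerC hB).
- apply: sumr_ge0 => i _; rewrite mulr_ge0 ?ler0c//; exact: semi_inner_ge0 hB _.
Qed.

Lemma le_of_pow2_le (R : realType) (K u l : R) : 0 <= l ->
  (forall k, u ^+ (2 ^ k) <= K * l ^+ (2 ^ k)) -> u <= l.
Proof.
move=> l0 H; rewrite leNgt; apply/negP => lu.
have u0 : 0 < u by exact: le_lt_trans lu.
have q0 : 0 <= l / u by rewrite divr_ge0// ltW.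
have q1 : `|l / u| < 1 by rewrite ger0_norm// ltr_pdivrMr// mul1r.
have K0 : 0 < `|K| + 1 by rewrite ltr_wpDl.
have iK0 : 0 < (`|K| + 1)^-1 by rewrite invr_gt0.
have /cvgrPdist_lt/(_ _ iK0)[N _ /(_ (2 ^ N)%N)] := cvg_expr q1.
rewrite sub0r normrN => /(_ (ltnW (ltn_expl N (leqnn 2)))).
rewrite ger0_norm ?exprn_ge0// expr_div_n.
have uN : 0 < u ^+ (2 ^ N) by rewrite exprn_gt0.
rewrite ltr_pdivrMr// mulrC ltr_pdivlMr// => hN.
have := H N; have lN : 0 <= l ^+ (2 ^ N) by rewrite exprn_ge0.
have := ler_wpM2r lN (ler_norm K); lra.
Qed.

(** * Bounds that are uniform over the states *)

Section States.
Context {R : realType} {A : cstarAlgType R}.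
Variables (a : A) (f : {scalar A}).
Hypothesis a_ge0 : positive_elt a.
Implicit Types (u v x y s : A).

Lemma semi_inner_state : positive_functional f ->
  semi_inner (fun u v => f (star v * a * u)).
Proof.
move=> pf; split=> [u v w|c u w|u v|u].
- by rewrite mulrDr linearD.
- by rewrite -scalerAr linearZ_LR.
- rewrite -(positive_functional_star pf) !starM starK (proj1 a_ge0).
  by rewrite !mulrA.
- exact: positive_functional_sandwich_ge0.
Qed.

Hypothesis fa : a_states a f.

Let pf : positive_functional f. Proof. by case: fa. Qed.

(** Cauchy-Schwarz against [1], a unit vector because [f a = 1]. *)
Lemma state_numerical_le x :
  cmod (f (a * x)) <= Num.sqrt (complex.Re (f (star x * a * x))).
Proof.
have := semi_inner_CauchySchwarz_sqrt (semi_inner_state pf) x 1.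
by rewrite star1 mul1r mulr1; case: fa => _ _ ->; rewrite /= sqrtr1 mulr1.
Qed.

(* Iterating Cauchy-Schwarz gives
   [f (a * s) ^+ (2 ^ k) <= f (a * s ^+ (2 ^ k))], and the right-hand side is
   at most a constant times [cnorm s ^+ (2 ^ k)]; so the bound on [f (a * s)]
   does not involve the norm of [f]. *)
Lemma state_selfadjoint_le s : is_a_adjoint a s s -> cmod (f (a * s)) <= cnorm s.
Proof.
move=> ass.
have asX m : a * s ^+ m = star (s ^+ m) * a.
  elim: m => [|m IH]; first by rewrite !expr0 star1 mulr1 mul1r.
  by rewrite exprSr mulrA IH -mulrA ass mulrA -starM -exprS -exprSr.
have sq m : cmod (f (a * s ^+ m)) ^+ 2 <= cmod (f (a * s ^+ (m + m))).
  have := state_numerical_le (s ^+ m); rewrite -asX -mulrA -exprD => h.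
  have h0 : 0 <= complex.Re (f (a * s ^+ (m + m))).
    rewrite exprD mulrA asX -ler0c RRe_real ?ger0_real//;
    exact: positive_functional_sandwich_ge0.
  apply: le_trans (Re_le_cmod _).
  rewrite -(sqr_sqrtr h0) ler_sqr ?nnegrE ?cmod_ge0 ?sqrtr_ge0//.
case: (fa) => -[M fM] _ _.
apply: (@le_of_pow2_le _ (`|M| * cnorm a)); first exact: cnorm_ge0.
move=> k; apply: (@le_trans _ _ (cmod (f (a * s ^+ (2 ^ k))))).
  elim: k => [|k IH]; first by rewrite expn0 !expr1.
  rewrite expnSr exprM; apply: le_trans (_ : cmod (f (a * s ^+ (2 ^ k))) ^+ 2 <= _).
    by rewrite ler_sqr ?nnegrE ?cmod_ge0 ?exprn_ge0 ?cmod_ge0.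
  by rewrite muln2 -addnn.
apply: (le_trans (fM _)); apply: (@le_trans _ _ (`|M| * cnorm (a * s ^+ (2 ^ k)))).
  by rewrite ler_wpM2r ?cnorm_ge0 ?ler_norm.
rewrite -mulrA ler_wpM2l//; apply: (le_trans (cnormM _ _)).
rewrite ler_wpM2l ?cnorm_ge0//.
by case: (2 ^ k)%N (expn_gt0 2 k) => // m _; exact: cnormX.
Qed.

(** [star x * a * x = a * (y * x)], and [y * x] is its own [a]-adjoint. The bound is the same for
    all states, so the suprema are finite. *)
Lemma state_adjointable_le x y : is_a_adjoint a x y ->
  Num.sqrt (complex.Re (f (star x * a * x))) <= Num.sqrt (cnorm (y * x)).
Proof.
move=> ax; rewrite ler_wsqrtr// -ax -mulrA; apply: le_trans (Re_le_cmod _) _.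
apply: state_selfadjoint_le; rewrite /is_a_adjoint mulrA ax.
have ya : star y * a = a * x.
  by have := congr1 star ax; rewrite !starM starK (proj1 a_ge0).
by rewrite starM -[RHS]mulrA ya mulrA.
Qed.

End States.

(** * Real values of extended suprema *)

Section FineSup.
Context {R : realType} {T : Type}.
Variables (D : set T) (v : T -> R).

(** [fine] sends both infinities to 0: [K] excludes [+oo] and the point [t] excludes [-oo]. *)
Lemma le_fine_ereal_sup (K : R) t : (forall s, D s -> v s <= K) -> D t ->
  v t <= fine (ereal_sup [set (v s)%:E | s in D]%classic).
Proof.
move=> vK Dt; rewrite -lee_fin fineK.
  by apply: ereal_sup_ubound; exists t.
rewrite fin_numE; apply/andP; split.
  by rewrite -ltNye; apply: lt_le_trans (ltNyr (v t)) (ereal_sup_ubound _); exists t.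
rewrite -ltey; apply: le_lt_trans (ltry K); apply: ge_ereal_sup => _ [s Ds <-].
by rewrite lee_fin vK.
Qed.

Lemma fine_ereal_sup_ge0 : (forall s, 0 <= v s) ->
  0 <= fine (ereal_sup [set (v s)%:E | s in D]%classic).
Proof.
move=> v0; have [->|/set0P[t Dt]] := eqVneq D set0.
  by rewrite image_set0 ereal_sup0.
by apply: fine_ge0; apply: le_trans (ereal_sup_ubound _); [|by exists t]; rewrite lee_fin.
Qed.

(** [0 <= K] settles the empty family, whose supremum [-oo] becomes 0 under [fine]. *)
Lemma fine_ereal_sup_le (K : R) : 0 <= K -> (forall s, D s -> v s <= K) ->
  fine (ereal_sup [set (v s)%:E | s in D]%classic) <= K.
Proof.
move=> K0 vK; have [->|/set0P[t Dt]] := eqVneq D set0.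
  by rewrite image_set0 ereal_sup0.
have : (ereal_sup [set (v s)%:E | s in D]%classic <= K%:E)%E.
  by apply: ge_ereal_sup => _ [s Ds <-]; rewrite lee_fin vK.
by case: ereal_sup => //= r; rewrite ?lee_fin.
Qed.

End FineSup.

(** * Calculus of [a]-adjoints and the inequality for the radius *)

Section Adjoints.
Context {R : realType} {A : cstarAlgType R}.
Variable a : A.
Implicit Types (x y z w : A).

Lemma is_a_adjoint_sym x y : star a = a -> is_a_adjoint a x y -> is_a_adjoint a y x.
Proof.
by move=> aa /(congr1 star); rewrite !starM starK aa => /esym.
Qed.

Lemma is_a_adjointM x y z w : is_a_adjoint a x y -> is_a_adjoint a z w ->
  is_a_adjoint a (x * z) (w * y).
Proof.
by rewrite /is_a_adjoint => ax az; rewrite mulrA az -mulrA ax mulrA starM.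
Qed.

Lemma is_a_adjoint_wsum (I : finType) (p : I -> R) (x y : I -> A) :
  (forall i, is_a_adjoint a (x i) (y i)) ->
  is_a_adjoint a (\sum_i (p i)%:C *: x i) (\sum_i (p i)%:C *: y i).
Proof.
rewrite /is_a_adjoint => axy; rewrite star_sum mulr_sumr mulr_suml.
by apply: eq_bigr => i _; rewrite starZr -scalerAr -scalerAl axy.
Qed.

Hypothesis a_ge0 : positive_elt a.

Lemma le_a_numerical_radius (f : {scalar A}) x y : a_states a f ->
  is_a_adjoint a x y -> cmod (f (a * x)) <= fine (a_numerical_radius a x).
Proof.
move=> fa ax; apply: (le_fine_ereal_sup (K := Num.sqrt (cnorm (y * x))) _ fa).
move=> g ga; apply: le_trans (state_numerical_le a_ge0 ga x) _.
exact: state_adjointable_le.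
Qed.

Lemma le_a_norm (f : {scalar A}) x y : a_states a f -> is_a_adjoint a x y ->
  Num.sqrt (complex.Re (f (star x * a * x))) <= fine (a_norm a x).
Proof.
move=> fa ax; apply: (le_fine_ereal_sup (K := Num.sqrt (cnorm (y * x))) _ fa).
by move=> g ga; exact: state_adjointable_le.
Qed.

Lemma a_numerical_radius_ge0 x : 0 <= fine (a_numerical_radius a x).
Proof. by apply: fine_ereal_sup_ge0 => f; exact: cmod_ge0. Qed.

Lemma state_Buzano (f : {scalar A}) (I : finType) (p : I -> R) (x xs : I -> A) :
  a_states a f -> (forall i, is_a_adjoint a (x i) (xs i)) ->
  (forall i, 0 <= p i) -> \sum_i p i = 1 ->
  2 * cmod (f (a * \sum_i (p i)%:C *: x i)) ^+ 2 <=
    cmod (f (a * \sum_i (p i)%:C *: x i ^+ 2)) +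
    Num.sqrt (complex.Re (f (a * \sum_i (p i)%:C *: (xs i * x i)))) *
    Num.sqrt (complex.Re (f (a * \sum_i (p i)%:C *: (x i * xs i)))).
Proof.
move=> fa ax p0 p1; have [_ pf f1] := fa.
have axs i := is_a_adjoint_sym (proj1 a_ge0) (ax i).
have hB := semi_inner_weighted_sum p0 (semi_inner_state a_ge0 pf).
pose u := [ffun i => x i]; pose v := [ffun i => xs i].
pose e := [ffun _ : I => 1 : A].
have fsum (F : I -> A) :
    \sum_i (p i)%:C * f (a * F i) = f (a * \sum_i (p i)%:C *: F i).
  rewrite mulr_sumr linear_sum; apply: eq_bigr => i _.
  by rewrite -scalerAr linearZ_LR.
have e1 : \sum_i (p i)%:C * f (star (e i) * a * e i) = 1.
  under eq_bigr do rewrite ffunE star1 mul1r mulr1 f1 mulr1.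
  by rewrite -rmorph_sum p1.
have := semi_inner_Buzano hB u v e1.
have -> : \sum_i (p i)%:C * f (star (e i) * a * u i) =
    f (a * \sum_i (p i)%:C *: x i).
  by rewrite -fsum; apply: eq_bigr => i _; rewrite !ffunE star1 mul1r.
(* Since [star (xs i) * a = a * x i], both factors in Buzano's product coincide, whence the
   square. *)
have -> : \sum_i (p i)%:C * f (star (v i) * a * e i) =
    f (a * \sum_i (p i)%:C *: x i).
  by rewrite -fsum; apply: eq_bigr => i _; rewrite !ffunE mulr1 -axs.
have -> : \sum_i (p i)%:C * f (star (v i) * a * u i) =
    f (a * \sum_i (p i)%:C *: x i ^+ 2).
  by rewrite -fsum; apply: eq_bigr => i _; rewrite !ffunE -axs -mulrA expr2.
have -> : \sum_i (p i)%:C * f (star (u i) * a * u i) =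
    f (a * \sum_i (p i)%:C *: (xs i * x i)).
  by rewrite -fsum; apply: eq_bigr => i _; rewrite !ffunE -ax -mulrA.
have -> : \sum_i (p i)%:C * f (star (v i) * a * v i) =
    f (a * \sum_i (p i)%:C *: (x i * xs i)).
  by rewrite -fsum; apply: eq_bigr => i _; rewrite !ffunE -axs -mulrA.
by rewrite cmodM -expr2.
Qed.

Lemma a_numerical_radius_wsum_le (I : finType) (p : I -> R) (x xs : I -> A) :
  (forall i, is_a_adjoint a (x i) (xs i)) ->
  (forall i, 0 <= p i) -> \sum_i p i = 1 ->
  2 * fine (a_numerical_radius a (\sum_i (p i)%:C *: x i)) ^+ 2 <=
    fine (a_numerical_radius a (\sum_i (p i)%:C *: x i ^+ 2)) +
    Num.sqrt (fine (a_norm a (\sum_i (p i)%:C *: (xs i * x i)))) *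
    Num.sqrt (fine (a_norm a (\sum_i (p i)%:C *: (x i * xs i)))).
Proof.
move=> ax p0 p1; set lhs := fine _; set r := (X in _ <= X).
have axs i := is_a_adjoint_sym (proj1 a_ge0) (ax i).
have r0 : 0 <= r by rewrite addr_ge0 ?a_numerical_radius_ge0// mulr_ge0 ?sqrtr_ge0.
(* The weighted sum of the [t i * s i] is its own [a]-adjoint, so its [a]-norm is finite and
   dominates [f] through Cauchy-Schwarz. *)
have normP s t : (forall i, is_a_adjoint a (s i) (t i)) ->
    forall f, a_states a f ->
    Num.sqrt (complex.Re (f (a * \sum_i (p i)%:C *: (t i * s i)))) <=
    Num.sqrt (fine (a_norm a (\sum_i (p i)%:C *: (t i * s i)))).
  move=> st f fa; rewrite ler_wsqrtr//; apply: le_trans (Re_le_cmod _) _.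
  apply: le_trans (state_numerical_le a_ge0 fa _) _.
  apply: le_a_norm fa (is_a_adjoint_wsum _ _) => i.
  exact: is_a_adjointM (is_a_adjoint_sym (proj1 a_ge0) (st i)) (st i).
(* Undoing the square leaves a bound on a supremum of moduli, to be checked state by state. *)
suff : lhs <= Num.sqrt (2^-1 * r).
  rewrite -(ler_sqr) ?nnegrE ?a_numerical_radius_ge0 ?sqrtr_ge0//.
  rewrite sqr_sqrtr ?mulr_ge0 ?invr_ge0//; lra.
apply: fine_ereal_sup_le; first exact: sqrtr_ge0.
move=> f fa; rewrite -(ler_sqr) ?nnegrE ?cmod_ge0 ?sqrtr_ge0//.
rewrite sqr_sqrtr ?mulr_ge0 ?invr_ge0//.
suff : 2 * cmod (f (a * \sum_i (p i)%:C *: x i)) ^+ 2 <= r by lra.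
apply: le_trans (state_Buzano fa ax p0 p1) _; apply: lerD.
  apply: le_a_numerical_radius fa (is_a_adjoint_wsum _ _) => i.
  rewrite expr2; exact: is_a_adjointM (ax i) (ax i).
by apply: ler_pM; rewrite ?sqrtr_ge0//; exact: normP.
Qed.

End Adjoints.

(** * Orlicz functions and the conclusion *)

Lemma orlicz_half (R : realType) (phi : R -> R) (u v : R) :
  orlicz_function phi -> 0 <= u -> 0 <= v ->
  phi (2^-1 * (u + v)) <= 2^-1 * phi u + 2^-1 * phi v.
Proof.
move=> hphi u0 v0.
have ui : u \in `[0, +oo[%classic by rewrite inE /= in_itv /= u0.
have vi : v \in `[0, +oo[%classic by rewrite inE /= in_itv /= v0.
have h0 : 0 <= 2^-1 :> R by rewrite invr_ge0.
have h1 : 2^-1 <= 1 :> R by rewrite invf_le1 ?ler1n.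
have half : 1 - 2^-1 = 2^-1 :> R by field.
rewrite mulrDr -{2 4}half; exact: (orlicz_convex hphi (Itv01 h0 h1) ui vi).
Qed.

Theorem theorem2p27 (R : realType) (A : cstarAlgType R) (a : A)
    (a_neq0 : a != 0) (a_ge0 : positive_elt a)
    (phi : R -> R) (phi_orlicz : orlicz_function phi)
    (n : nat) (n_ge1 : (1 <= n)%N)
    (x xs : 'I_n -> A) (x_Aa : forall i, a_adjointable a (x i))
    (xs_adj : forall i, is_a_adjoint a (x i) (xs i))
    (p : 'I_n -> R) (p_ge0 : forall i, 0 <= p i) (p_sum1 : \sum_(i < n) p i = 1) :
  phi (fine (a_numerical_radius a (\sum_(i < n) (p i)%:C%C *: x i)) ^+ 2) <=
    2^-1 * phi (fine (a_numerical_radius a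
                        (\sum_(i < n) (p i)%:C%C *: (x i) ^+ 2))) +
    2^-1 * phi (Num.sqrt (fine (a_norm a
                        (\sum_(i < n) (p i)%:C%C *: (xs i * x i)))) *
                Num.sqrt (fine (a_norm a
                        (\sum_(i < n) (p i)%:C%C *: (x i * xs i))))).
Proof.
have le2 := a_numerical_radius_wsum_le a_ge0 xs_adj p_ge0 p_sum1.
(* Convexity replaces the right-hand side by [phi] at a midpoint; monotonicity then reduces the
   claim to [le2]. *)
apply: le_trans (orlicz_half phi_orlicz _ _); last 2 first.
- exact: a_numerical_radius_ge0.
- by rewrite mulr_ge0 ?sqrtr_ge0.
have sq0 y : 0 <= fine (a_numerical_radius a y) ^+ 2 by rewrite sqr_ge0.
apply: (orlicz_homo phi_orlicz); first by rewrite in_itv /= sq0.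
  rewrite in_itv /= andbT mulr_ge0 ?invr_ge0//.
  by rewrite addr_ge0 ?a_numerical_radius_ge0// mulr_ge0 ?sqrtr_ge0.
by rewrite -(ler_pM2l (ltr0n R 2)) [leRHS]mulrA mulfV// mul1r.
Qed.
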